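(* Let $R=K[x,y,z]$ with $\operatorname{char} K = 0$, and let $I\subset R$ be an Artinian ideal whose minimal monomial generators have degrees $d_1,\ldots,d_t$. Set $$d := \frac{d_1+\cdots+d_t}{t-1}.$$ Assume that the following conditions are satisfied: (i) The number $d$ is an integer. (ii) For all $i=1,\ldots,t$, one has $d>d_i$. (iii) Each degree of a least common multiple of two distinct minimal generators of $I$ is at least $d$. Then the syzygy bundle of $I$ is semistable if $R/I$ has the weak Lefschetz property.
   Context: $I$ is a monomial ideal. An Artinian standard graded $K$-algebra $A$ has the weak Lefschetz property if there is a linear form $\ell\in[A]_1$ such that for all integers $j$ the multiplication map $\times\ell:[A]_j\to[A]_{j+1}$ has maximal rank (is injective or surjective). If $g_1,\dots,g_t$ are the minimal monomial generators of $I$, the syzygy module $\operatorname{syz} I$ is the kernel of the surjection $\bigoplus_{i=1}^t R(-\deg g_i)\to I$, and the syzygy bundle of $I$ is its sheafification on $\mathbb{P}^2$, of rank $t-1$. A vector bundle $E$ is semistable if $\mu(F)\le\mu(E)$ for every non-zero coherent subsheaf $F\subset E$, where $\mu=c_1/\operatorname{rk}$. (By a theorem of Brenner, for monomial ideals in characteristic zero this is equivalent to: for every proper subset $J\subset\{1,\dots,t\}$ with at least two elements, $\frac{d_J-\sum_{j\in J}\deg g_j}{|J|-1}\le\frac{-\sum_{i=1}^t\deg g_i}{t-1}$, where $d_J$ is the degree of $\gcd\{g_j: j\in J\}$; this may be taken as the definition of semistability.) *)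

(* Defs.v *)
From HB Require Import structures.
From mathcomp Require Import all_boot all_order all_algebra.
From mathcomp Require Export mpoly.

Set Implicit Arguments.
Unset Strict Implicit.
Unset Printing Implicit Defensive.

Import Order.TTheory GRing.Theory Num.Theory.
Local Open Scope ring_scope.

Section Ideals.
Variables (n : nat) (K : fieldType).
Implicit Types I J : {mpoly K[n]} -> Prop.

Definition is_ideal I : Prop :=
  [/\ I 0, forall f g, I f -> I g -> I (f + g)
    & forall f g, I g -> I (f * g)].

Definition generated_by t (g : 'I_t -> 'X_{1..n}) (S : {set 'I_t}) I : Prop :=
  forall f, I f <->
    exists h : 'I_t -> {mpoly K[n]}, f = \sum_(i in S) h i * 'X_[g i].

(* The family [g] generates [I] and no proper subfamily does.  In particular
   [g] is injective and no [g i] divides another one. *)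
Definition minimal_monomial_generators I t (g : 'I_t -> 'X_{1..n}) : Prop :=
  generated_by g setT I /\
  forall S : {set 'I_t}, generated_by g S I -> S = setT.

(* Descending chain condition on the ideals of the quotient ring by [I], the
   latter being identified with the ideals of the polynomial ring that
   contain [I]. *)
Definition artinian I : Prop :=
  is_ideal I /\
  forall J : nat -> {mpoly K[n]} -> Prop,
    (forall k, is_ideal (J k)) ->
    (forall k f, I f -> J k f) ->
    (forall k f, J k.+1 f -> J k f) ->
    exists N, forall k, (N <= k)%N -> forall f, J N f <-> J k f.

(* Multiplication by the class of [l] from degree [j] to degree [j + 1] of the
   quotient by [I], in terms of homogeneous representatives. *)
Definition mul_injective I (l : {mpoly K[n]}) (j : nat) : Prop :=
  forall f, f \is j.-homog -> I (l * f) -> I f.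

Definition mul_surjective I (l : {mpoly K[n]}) (j : nat) : Prop :=
  forall f, f \is (j.+1).-homog ->
    exists2 u, u \is j.-homog & I (f - l * u).

(* For negative [j] the source is zero and the map is injective, so that it is
   enough to let [j] range over the natural numbers. *)
Definition weak_lefschetz I : Prop :=
  exists2 l : {mpoly K[n]}, l \is 1.-homog &
    forall j : nat, mul_injective I l j \/ mul_surjective I l j.

End Ideals.

Section Syzygies.
Variables (n t : nat) (g : 'I_t -> 'X_{1..n}).

(* The maximum only serves as a neutral element for [minn]; the empty family
   gets gcd 1. *)
Definition mgcd (J : {set 'I_t}) : 'X_{1..n} :=
  [multinom \big[minn/(\max_(j in J) g j k)%N]_(j in J) g j k | k < n].

Lemma mgcdP (J : {set 'I_t}) (m : 'X_{1..n}) : J != set0 ->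
  reflect (forall j, j \in J -> (m <= g j)%MM) (m <= mgcd J)%MM.
Proof.
move=> J0; apply: (iffP forallP) => [le_m j jJ | le_m k].
  apply/forallP => k; apply: leq_trans (le_m k) _.
  rewrite mnmE; move: (bigop.body 0%N _ _) => M.
  elim: (index_enum _) (mem_index_enum j) => //= i s IHs.
  rewrite big_cons inE => /predU1P[<-|/IHs le_s]; first by rewrite jJ geq_minl.
  by case: ifP => // _; rewrite geq_min le_s orbT.
have [j0 j0J] := set0Pn J J0.
rewrite mnmE; elim/big_ind: _ => [|a b ma mb|j jJ].
- by rewrite (bigD1 j0) //= leq_max (forallP (le_m _ j0J) k).
- by rewrite leq_min ma mb.
- exact: (forallP (le_m _ jJ) k).
Qed.

Definition degree_ratio : rat :=
  (\sum_(i < t) mdeg (g i))%:R / (t%:R - 1).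

(* Semistability of the syzygy bundle of the monomial ideal with minimal
   generators [g], in Brenner's numerical form: the left-hand side is the slope
   of the syzygy subsheaf of the generators indexed by [J], the right-hand side
   that of the whole bundle. *)
Definition syzygy_bundle_semistable : Prop :=
  forall J : {set 'I_t}, J \proper [set: 'I_t] -> (2 <= #|J|)%N ->
    ((mdeg (mgcd J))%:R - (\sum_(j in J) mdeg (g j))%:R) / (#|J|%:R - 1)
    <= - (\sum_(i < t) mdeg (g i))%:R / (t%:R - 1) :> rat.

End Syzygies.

(* Main.v *)
(* Since two distinct generators have no common multiple of degree less than
   [d], inclusion-exclusion in degrees [d - 2] and [d - 1] has no higher terms.
   It shows that [R/I] has as many standard monomials in degree [d - 2] as in
   degree [d - 1], so that the weak Lefschetz property makes multiplication by
   [l] bijective between these degrees.  Given [J], let [m] be the gcd of its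
   generators.  Multiplication by [l] maps multiples of [m] to multiples of [m],
   hence the standard multiples of [m] of degree [d - 2] are at most as many as
   those of degree [d - 1].  By inclusion-exclusion again this reads
   [\sum_i (d - deg (lcm m g_i))^+ <= d - deg m], and keeping only the terms
   with [i \in J], where [lcm m g_i = g_i], gives Brenner's inequality for [J]. *)
Require Import Defs.
From mathcomp Require Import all_boot all_order all_algebra.
From mathcomp Require Import zify ring lra.
Import Order.TTheory GRing.Theory Num.Theory.
Local Open Scope ring_scope.

(** * Linear algebra: ranks of a matrix and of its blocks *)

Section SupportOfBijection.
Variables (F : fieldType) (T : finType) (A B : {set T}) (c : T -> T -> F).

Definition combination (x : T -> F) (v : T) : F := \sum_(u in A) x u * c u v.

Definition combination_injective : Prop := forall x : T -> F,
  (forall v, v \in B -> combination x v = 0) -> forall u, u \in A -> x u = 0.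

Definition combination_surjective : Prop := forall y : T -> F,
  exists x : T -> F, forall v, v \in B -> combination x v = y v.

(** The matrix of [c] is square, and a square matrix of full rank has independent rows. *)
Lemma combination_surjective_injective :
  #|A| = #|B| -> combination_surjective -> combination_injective.
Proof.
move=> cardAB surj.
pose M := \matrix_(i < #|A|, j < #|B|) c (enum_val i) (enum_val j).
have mulM (x : T -> F) j :
    ((\row_(i < #|A|) x (enum_val i)) *m M) 0 j = combination x (enum_val j).
  rewrite !mxE /combination [RHS]big_enum_val.
  by apply: eq_bigr => i _; rewrite !mxE.
have fullM : row_full M.
  rewrite -sub1mx; apply/row_subP => j0; apply/submxP.
  (* A preimage of an indicator function puts a unit row vector in the row space. *)
  have [x xP] := surj (fun v => (v == enum_val j0)%:R).
  exists (\row_(i < #|A|) x (enum_val i)); apply/rowP => j.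
  rewrite mulM xP ?enum_valP // !mxE (inj_eq enum_val_inj).
  by rewrite eq_sym.
have freeM : row_free M by rewrite /row_free (eqP fullM) cardAB.
move=> x x0 u uA.
have : \row_(i < #|A|) x (enum_val i) = 0.
  apply: (row_free_inj freeM); rewrite mul0mx; apply/rowP => j.
  by rewrite mulM x0 ?enum_valP // mxE.
by move/rowP/(_ (enum_rank_in uA u)); rewrite !mxE enum_rankK_in.
Qed.

(** Within [B], the rows indexed by [S] vanish off [S']. So a relation between the rows of the block
    [S] by [S'] is already one between full rows, hence trivial, and the rank of the block is
    [#|S|]. *)
Lemma leq_card_support (S S' : {set T}) :
    combination_injective -> S \subset A ->
    (forall u v, u \in S -> v \in B -> v \notin S' -> c u v = 0) ->
  (#|S| <= #|S'|)%N.
Proof.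
move=> inj sSA c0.
pose N := \matrix_(i < #|S|, j < #|S'|) c (enum_val i) (enum_val j).
suff freeN : row_free N by rewrite -(eqP freeN) rank_leq_col.
apply: inj_row_free => r rN0.
(* Extension of the row vector [r] by zero outside [S]. *)
pose x u := \sum_(i < #|S|) r 0 i * (enum_val i == u)%:R.
have xE i : x (enum_val i) = r 0 i.
  rewrite /x (bigD1 i) //= eqxx mulr1 big1 ?addr0 // => j ji.
  by rewrite (inj_eq enum_val_inj) (negPf ji) mulr0.
have combE v : combination x v = \sum_(i < #|S|) r 0 i * c (enum_val i) v.
  rewrite /combination; under eq_bigr => u _ do rewrite mulr_suml.
  rewrite exchange_big; apply: eq_bigr => i _ /=.
  have iA : enum_val i \in A by rewrite (subsetP sSA) ?enum_valP.
  rewrite (bigD1 _ iA) /= eqxx mulr1 big1 ?addr0 // => u /andP[_ ui].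
  by rewrite eq_sym (negPf ui) mulr0 mul0r.
apply/rowP => i; rewrite mxE -xE; apply: inj; last first.
  by rewrite (subsetP sSA) ?enum_valP.
move=> v vB; rewrite combE; have [vS'|vS'] := boolP (v \in S'); last first.
  by rewrite big1 // => j _; rewrite c0 ?mulr0 // enum_valP.
move/rowP/(_ (enum_rank_in vS' v)): rN0; rewrite !mxE => N0; rewrite -[RHS]N0.
by apply: eq_bigr => j _; rewrite mxE enum_rankK_in.
Qed.

End SupportOfBijection.

Arguments combination {F T}.
Arguments combination_injective {F T}.
Arguments combination_surjective {F T}.

Lemma leq_mdeg {n} {u w : 'X_{1..n}} : (u <= w)%MM -> (mdeg u <= mdeg w)%N.
Proof. by move=> /forallP uw; rewrite !mdegE leq_sum. Qed.

(** * Counting standard monomials in a given degree *)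

Section Counting.
(* The bound on degrees is only there to work in a finite type of monomials. *)
Variable b : nat.

Definition multiples {n} (e : nat) (m : 'X_{1..n}) : {set 'X_{1..n < b}} :=
  [set w : 'X_{1..n < b} | (mdeg w == e) && (m <= w)%MM].

Definition standard {n t} (g : 'I_t -> 'X_{1..n}) (e : nat) :
    {set 'X_{1..n < b}} :=
  [set w : 'X_{1..n < b} | (mdeg w == e) && [forall i, ~~ (g i <= w)%MM]].

(* Multiplication by the first variable maps the multiples of degree [e]
   injectively to those of degree [e + 1]; the image misses exactly the
   monomials [edge i], whose first exponent is that of [m]. *)
Lemma card_multiples3 (e : nat) (m : 'X_{1..3}) : (e.+1 < b)%N ->
  #|multiples e.+1 m| = (#|multiples e m| + (e.+2 - mdeg m))%N.
Proof.
move=> eb; pose i0 : 'I_3 := ord0; pose i1 : 'I_3 := lift ord0 ord0.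
pose i2 : 'I_3 := ord_max.
have mdeg3 (w : 'X_{1..3}) : mdeg w = (w i0 + w i1 + w i2)%N.
  rewrite mdegE !big_ord_recl big_ord0 addn0 addnA; congr (_ + _ + w _)%N.
  exact: val_inj.
have lem3 (u w : 'X_{1..3}) :
    (u <= w)%MM = [&& u i0 <= w i0, u i1 <= w i1 & u i2 <= w i2]%N.
  apply/forallP/and3P => [H|[h0 h1 h2]]; first by split; apply: H.
  move=> i; case: i => -[|[|[|//]]] ?.
  - by rewrite (_ : Ordinal _ = i0) //; apply: val_inj.
  - by rewrite (_ : Ordinal _ = i1) //; apply: val_inj.
  - by rewrite (_ : Ordinal _ = i2) //; apply: val_inj.
have mnmP3 (u w : 'X_{1..3}) :
    u i0 = w i0 -> u i1 = w i1 -> u i2 = w i2 -> u = w.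
  move=> h0 h1 h2; apply/mnmP => -[[|[|[|//]]] ?].
  - by rewrite (_ : Ordinal _ = i0) //; apply: val_inj.
  - by rewrite (_ : Ordinal _ = i1) //; apply: val_inj.
  - by rewrite (_ : Ordinal _ = i2) //; apply: val_inj.
have b0 : (0 < b)%N by lia.
have mdeg00 : (mdeg (0%MM : 'X_{1..3}) < b)%N by rewrite mdeg0.
(* The default monomial 1 is never met: [bm] is only evaluated in degrees below [b]. *)
pose bm := insubd (BMultinom mdeg00).
have bmE w : (mdeg w < b)%N -> bmnm (bm w) = w by move=> ?; rewrite /bm insubdK.
pose up (w : 'X_{1..3 < b}) := bm (w + U_(i0))%MM.
pose edge (i : 'I_(e.+2 - mdeg m)) :=
  bm [multinom if j == i0 then m i0 else
     (if j == i1 then m i1 + i else e.+1 - m i0 - m i1 - i)%N | j < 3].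
have edgeE i : [/\ edge i i0 = m i0, edge i i1 = (m i1 + i)%N
    & edge i i2 = (e.+1 - m i0 - m i1 - i)%N].
  rewrite /edge bmE; first by rewrite !mnmE.
  rewrite mdeg3 !mnmE /=; have := ltn_ord i; have := mdeg3 m; lia.
have upE w : w \in multiples e m ->
    [/\ up w i0 = (w i0).+1, up w i1 = w i1 & up w i2 = w i2].
  rewrite inE => /andP[/eqP we _]; rewrite /up bmE ?mdegD ?mdeg1; last by lia.
  by rewrite !mnmDE !mnm1E /= addn1 !addn0.
have -> : multiples e.+1 m = up @: multiples e m :|: edge @: setT.
  apply/setP => w; apply/idP/setUP.
    rewrite inE mdeg3 lem3 => /andP[/eqP we /and3P[h0 h1 h2]].
    have [w0|w0] := ltnP (m i0) (w i0).
      have vE : bmnm (bm (w - U_(i0))%MM) = (w - U_(i0))%MM.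
        by rewrite bmE // (leq_ltn_trans (mdegB _ _)) // bmdeg.
      have vM : bm (w - U_(i0))%MM \in multiples e m.
        by rewrite inE vE mdeg3 lem3 !mnmBE !mnm1E /=; lia.
      left; apply/imsetP; exists (bm (w - U_(i0))%MM) => //.
      have [u0 u1 u2] := upE _ vM.
      by apply/val_inj/mnmP3; rewrite /= ?u0 ?u1 ?u2 vE !mnmBE !mnm1E /=; lia.
    have iP : (w i1 - m i1 < e.+2 - mdeg m)%N by rewrite mdeg3; lia.
    right; apply/imsetP; exists (Ordinal iP) => //.
    have [u0 u1 u2] := edgeE (Ordinal iP).
    by apply/val_inj/mnmP3; rewrite /= ?u0 ?u1 ?u2 /=; lia.
  case=> /imsetP[v vM ->]; rewrite inE mdeg3 lem3.
    have [-> -> ->] := upE _ vM; move: vM; rewrite inE mdeg3 lem3; lia.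
  have [-> -> ->] := edgeE v; have := ltn_ord v; have := mdeg3 m; lia.
rewrite cardsU disjoint_setI0 ?cards0 ?subn0.
  rewrite !card_in_imset ?cardsT ?card_ord //.
    move=> i j _ _ /(congr1 (fun w : 'X_{1..3 < b} => w i1)).
    have [_ -> _] := edgeE i; have [_ -> _] := edgeE j => /addnI.
    exact: val_inj.
  move=> u v uM vM uv; have [u0 u1 u2] := upE _ uM; have [v0 v1 v2] := upE _ vM.
  apply/val_inj/mnmP3 => /=; rewrite uv in u0 u1 u2; lia.
rewrite -setI_eq0; apply/eqP/setP => w; rewrite !inE; apply/negP.
move=> /andP[/imsetP[u uM wu] /imsetP[i _ wi]].
have [u0 _ _] := upE _ uM; have [i0E _ _] := edgeE i.
move: uM; rewrite inE lem3 => /and4P[_ h _ _].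
by rewrite -wu wi in u0; lia.
Qed.

(** A monomial of degree [e] is divisible by at most one generator, since two of them would force
    their lcm to divide it. Hence the sets of multiples removed are disjoint. *)
Lemma card_standard_multiples n t (g : 'I_t -> 'X_{1..n}) (e : nat) m :
    (forall i j, i != j -> (e < mdeg (mlcm (g i) (g j)))%N) ->
  (#|standard g e :&: multiples e m| + \sum_i #|multiples e (mlcm m (g i))|)%N
    = #|multiples e m|.
Proof.
move=> lcm_gt; have cardE (P : pred 'X_{1..n < b}) :
    #|[set w in multiples e m | P w]| = (\sum_(w in multiples e m) P w)%N.
  by rewrite -sum1dep_card big_mkcondr; apply: eq_bigr => w _; case: (P w).
have -> : standard g e :&: multiples e m =
    [set w in multiples e m | [forall i, ~~ (g i <= w)%MM]].
  by apply/setP => w; rewrite !inE; case: eqP => //=; rewrite andbC.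
have multE i : multiples e (mlcm m (g i)) =
    [set w in multiples e m | (g i <= w)%MM].
  by apply/setP => w; rewrite !inE lem_mlcm andbA.
under [X in (_ + X)%N]eq_bigr => i _ do rewrite multE cardE.
(* Double counting: each multiple [w] of [m] contributes exactly 1, being either standard or
   divisible by a single generator. *)
rewrite exchange_big cardE -big_split -sum1_card; apply: eq_bigr => w /=.
rewrite inE => /andP[/eqP we _].
have [/forallP w0|] := boolP [forall i, ~~ (g i <= w)%MM].
  by rewrite big1 // => i _; rewrite (negPf (w0 i)).
rewrite negb_forall => /existsP[i]; rewrite negbK => iw.
rewrite (bigD1 i) //= iw big1 // => j ji; apply/eqP; rewrite eqb0.
apply/negP => jw.
have := lcm_gt _ _ ji; rewrite ltnNge -we leq_mdeg //.
by rewrite lem_mlcm jw.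
Qed.

(** Difference of the previous count between degrees [e + 1] and [e]. Truncated subtraction plays
    the part of the positive part: a monomial of degree above [e + 1] has no multiples in either
    degree. *)
Lemma card_standard_multiplesS t (g : 'I_t -> 'X_{1..3}) (e : nat) m :
    (e.+1 < b)%N ->
    (forall i j, i != j -> (e.+1 < mdeg (mlcm (g i) (g j)))%N) ->
  (#|standard g e.+1 :&: multiples e.+1 m|
     + \sum_i (e.+2 - mdeg (mlcm m (g i))))%N
    = (#|standard g e :&: multiples e m| + (e.+2 - mdeg m))%N.
Proof.
move=> eb lcm_gt.
have := card_standard_multiples _ _ g e.+1 m lcm_gt.
have lcm_gt' i j : i != j -> (e < mdeg (mlcm (g i) (g j)))%N.
  by move=> ij; apply: ltnW; apply: lcm_gt.
have := card_standard_multiples _ _ g e m lcm_gt'.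
under [X in _ -> (_ + X)%N = _ -> _]eq_bigr => i _ do
  rewrite card_multiples3 //.
rewrite card_multiples3 // big_split /=; lia.
Qed.

End Counting.

(** * From multiplication modulo the ideal to matrices on standard monomials *)

Section Polynomials.
Variables (n : nat) (K : fieldType) (I : {mpoly K[n]} -> Prop).
Variables (t : nat) (g : 'I_t -> 'X_{1..n}).
Hypotheses (idI : is_ideal I) (genI : generated_by g setT I).

Lemma monomial_idealP f :
  I f <-> forall w, w \in msupp f -> exists i, (g i <= w)%MM.
Proof.
have [I0 ID IM] := idI.
split=> [/genI[h ->] w wh | wf].
  apply/existsP; apply: contraTT wh; rewrite negb_exists => /forallP gw.
  rewrite -mcoeff_eq0 raddf_sum big1 // => i _; apply/eqP; rewrite mcoeff_eq0.
  apply: contra (gw i); rewrite (perm_mem (msuppMX _ _)) => /mapP[u _ ->].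
  exact: lem_addr.
rewrite (mpolyE f) big_seq; elim/big_ind: _ => // w /wf[i iw].
rewrite -(submK iw) mpolyXD scalerAl; apply: IM; apply/genI.
exists (fun j => (j == i)%:R); rewrite (bigD1 i) ?inE //= eqxx mul1r.
by rewrite big1 ?addr0 // => j /andP[_ /negPf ->]; rewrite mul0r.
Qed.

Variables (b e : nat) (l : {mpoly K[n]}).
Hypotheses (eb : (e.+1 < b)%N) (hom_l : l \is 1.-homog).
Let A := standard b g e.
Let B := standard b g e.+1.
(** For [u] in [A] and [v] in [B], this is the matrix of multiplication by [l] on the quotient, in
    the bases of standard monomials. *)
Let c (u v : 'X_{1..n < b}) : K := (l * 'X_[u])@_v.

Let mcoeff_combination x (v : 'X_{1..n < b}) :
  (l * \sum_(u in A) x u *: 'X_[u])@_v = combination A c x v.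
Proof.
rewrite mulr_sumr raddf_sum; apply: eq_bigr => u _ /=.
by rewrite -scalerAr mcoeffZ.
Qed.

Let homog_combination (C : {set 'X_{1..n < b}}) (k : nat) (x : _ -> K) :
    (forall u, u \in C -> mdeg u = k) ->
  \sum_(u in C) x u *: 'X_[u] \is k.-homog.
Proof.
move=> Ck; apply: rpred_sum => u uC.
by apply: rpredZ; rewrite dhomogX /= Ck.
Qed.

Let mcoeff_sum_set (C : {set 'X_{1..n < b}}) (x : _ -> K) (u : 'X_{1..n < b}) :
  u \in C -> (\sum_(w in C) x w *: 'X_[w])@_u = x u.
Proof.
move=> uC; rewrite raddf_sum (bigD1 u) //= mcoeffZ mcoeffX eqxx mulr1.
rewrite big1 ?addr0 // => w /andP[_ wu].
by rewrite mcoeffZ mcoeffX -bmeqP (negPf wu) mulr0.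
Qed.

(** A kernel vector gives a form [f] such that [l * f] has no standard monomial, so [f] lies in [I];
    but [f] is supported on standard monomials, hence zero. *)
Lemma mul_injective_combination :
  mul_injective I l e -> combination_injective A B c.
Proof.
move=> inj x x0 u uA; pose f := \sum_(u in A) x u *: 'X_[u].
have hom_f : f \is e.-homog.
  by apply: homog_combination => w; rewrite inE => /andP[/eqP].
have /monomial_idealP If : I f.
  apply: inj => //; apply/monomial_idealP => w wlf; apply/existsP.
  have := dhomog_mf (dhomogM hom_l hom_f) wlf; rewrite /= add1n => we.
  apply: contraTT wlf; rewrite negb_exists => gw.
  have wb : (mdeg w < b)%N by rewrite we.
  rewrite -mcoeff_eq0 (mcoeff_combination x (BMultinom wb)) x0 //.
  by rewrite inE /= we eqxx.
apply/eqP; rewrite -(mcoeff_sum_set A x u uA) mcoeff_eq0.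
apply/negP => /If[i iu]; move: uA; rewrite inE => /andP[_ /forallP/(_ i)].
by rewrite iu.
Qed.

(** A preimage modulo [I] may involve nonstandard monomials; these lie in [I], so dropping them
    leaves the coefficients of the product at standard monomials unchanged. *)
Lemma mul_surjective_combination :
  mul_surjective I l e -> combination_surjective A B c.
Proof.
move=> surj y; pose f := \sum_(v in B) y v *: 'X_[v].
have [|u hom_u /monomial_idealP Ifu] := surj f.
  by apply: homog_combination => w; rewrite inE => /andP[/eqP].
exists (fun w : 'X_{1..n < b} => u@_w) => v vB.
rewrite -(mcoeff_sum_set B y v vB) -/f.
have gv i : ~~ (g i <= v)%MM.
  by move: vB; rewrite inE => /andP[_ /forallP].
have -> : f@_v = (l * u)@_v.
  apply/eqP; rewrite -subr_eq0 -mcoeffB mcoeff_eq0; apply/negP => /Ifu[i].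
  by rewrite (negPf (gv i)).
rewrite -mcoeff_combination.
apply/esym/eqP; rewrite -subr_eq0 -mcoeffB -mulrBr mcoeff_eq0.
(* The nonstandard part of [u], shown below to lie in [I]. *)
set r := u - _.
have hom_r : r \is e.-homog.
  apply: rpredB => //.
  by apply: homog_combination => w; rewrite inE => /andP[/eqP].
suff /monomial_idealP Ilr : I (l * r).
  by apply/negP => /Ilr[i]; rewrite (negPf (gv i)).
have [_ _ IM] := idI; apply/IM/monomial_idealP => w wr; apply/existsP.
have we := dhomog_mf hom_r wr; rewrite /= in we.
apply: contraTT wr; rewrite negb_exists => gw.
have wb : (mdeg w < b)%N by rewrite we ltnW.
have wA : BMultinom wb \in A by rewrite inE /= we eqxx.
have := mcoeff_sum_set A (fun w : 'X_{1..n < b} => u@_w) _ wA.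
by rewrite -mcoeff_eq0 mcoeffB => ->; rewrite subrr.
Qed.

(** The entry [c u v] vanishes unless [u] divides [v], so the rows of multiples of [m] are supported
    on columns of multiples of [m]. *)
Lemma mul_injective_or_surjective_leq_card (m : 'X_{1..n}) :
    mul_injective I l e \/ mul_surjective I l e -> #|A| = #|B| ->
  (#|A :&: multiples b e m| <= #|B :&: multiples b e.+1 m|)%N.
Proof.
move=> inj_surj cardAB; apply: (@leq_card_support _ _ A B c).
- case: inj_surj => [/mul_injective_combination //|].
  by move/mul_surjective_combination/combination_surjective_injective; apply.
- exact: subsetIl.
move=> u v /setIP[_ /[!inE] /andP[_ mu]] vB.
rewrite vB; have /andP[-> _] := vB => /= mv.
apply/eqP; rewrite mcoeff_eq0; apply: contra mv.
rewrite (perm_mem (msuppMX _ _)) => /mapP[w _ ->].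
exact: lepm_trans mu (lem_addr _ _).
Qed.

End Polynomials.

Theorem theorem8p28 (K : fieldType) (charK0 : [pchar K] =i pred0)
    (I : {mpoly K[3]} -> Prop) (artI : artinian I)
    (t : nat) (g : 'I_t -> 'X_{1..3})
    (gensI : minimal_monomial_generators I g)
    (d_int : degree_ratio g \is a Num.int)
    (d_gt : forall i : 'I_t, (mdeg (g i))%:R < degree_ratio g)
    (d_lcm : forall i j : 'I_t, i != j ->
       degree_ratio g <= (mdeg (mlcm (g i) (g j)))%:R) :
  weak_lefschetz I -> syzygy_bundle_semistable g.
Proof.
move=> [l hom_l wlp] J properJ J2.
have [idI _] := artI; have [genI _] := gensI.
have [j0 j0J] : exists j, j \in J by apply/set0Pn; rewrite -card_gt0; lia.
have t3 : (2 < t)%N.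
  by have := proper_card properJ; rewrite cardsT card_ord; lia.
have /natrP[D ratioE] : degree_ratio g \is a Num.nat.
  by rewrite natrEint d_int (le_trans _ (ltW (d_gt j0))).
rewrite mulNr -/(degree_ratio g) ratioE.
have deg_gt i : (mdeg (g i) < D)%N by have := d_gt i; rewrite ratioE ltr_nat.
have lcm_ge i j : i != j -> (D <= mdeg (mlcm (g i) (g j)))%N.
  by move=> /d_lcm; rewrite ratioE ler_nat.
(* The definition of [D] with its denominator [t - 1] cleared, written without subtraction. *)
have sumE : (\sum_i mdeg (g i) + D = D * t)%N.
  apply/eqP; rewrite -(eqr_nat rat) natrD natrM -ratioE /degree_ratio.
  have : (2%:R < t%:R :> rat) by rewrite ltr_nat.
  move: (\sum_(i < t) _)%N => s t2; apply/eqP; field.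
  by rewrite subr_eq0 gt_eqF //; lra.
have subE (S : {set 'I_t}) :
    (\sum_(i in S) (D - mdeg (g i)) + \sum_(i in S) mdeg (g i) = D * #|S|)%N.
  rewrite -big_split mulnC -sum_nat_const; apply: eq_bigr => i _ /=.
  by rewrite subnK // ltnW.
(* [D = 0] contradicts [deg_gt]; [D = 1] makes all generators constant, so that [sumE] yields
   [t = 1]. *)
have [e De] : exists e, D = e.+2.
  move: deg_gt sumE; case: D {ratioE lcm_ge subE} => [|[|e]] deg_gt sumE.
  - by have := deg_gt j0.
  - move: sumE; rewrite big1; last by move=> i _; have := deg_gt i; lia.
    by lia.
  - by exists e.
have cardS m := card_standard_multiplesS e.+2 _ g e m (ltnSn _).
rewrite -De in cardS; have {}cardS m := cardS m lcm_ge.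
have mult0 k : multiples D k 0 = [set w : 'X_{1..3 < D} | mdeg w == k].
  apply/setP => w; rewrite !inE; case: eqP => //= _.
  by apply/forallP => i; rewrite mnm0E.
have standard0 k : standard D g k :&: multiples D k 0 = standard D g k.
  by rewrite mult0; apply/setIidPl/subsetP => w; rewrite !inE => /andP[].
(* Case [m = 1] of [cardS]: the sum of the [D - mdeg (g i)] is [D * t - (D * t - D) = D], which
   cancels against [D - 0]. *)
have cardAB : #|standard D g e| = #|standard D g e.+1|.
  have := cardS 0%MM; rewrite !standard0 mdeg0 subn0.
  under eq_bigr => i _ do rewrite mlc0m.
  have := subE setT; rewrite cardsT card_ord.
  under eq_bigl => i do rewrite inE.
  under [X in (_ + X)%N = _ -> _]eq_bigl => i do rewrite inE.
  by rewrite -sumE addnC => /addnI -> /addIn.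
pose m := mgcd g J.
have J0 : J != set0 by apply/set0Pn; exists j0.
have mJ j : j \in J -> (m <= g j)%MM by move: j; apply/(mgcdP _ _ J0)/lepm_refl.
have eD : (e.+1 < D)%N by rewrite De.
have := mul_injective_or_surjective_leq_card
  _ _ _ _ _ idI genI _ _ _ eD hom_l m (wlp e) cardAB.
have := cardS m.
have sumJ : (\sum_(j in J) (D - mdeg (g j)) <=
    \sum_i (D - mdeg (mlcm m (g i))))%N.
  rewrite [leqRHS](bigID (mem J)) /= (leq_trans _ (leq_addr _ _)) // leq_sum //.
  move=> j jJ; suff -> : mlcm m (g j) = g j by [].
  apply/mnmP => k; rewrite mnmE; apply/maxn_idPr; exact: (forallP (mJ j jJ) k).
(* Ensures that [D - mdeg m] is not truncated. *)
have dm : (mdeg m <= D)%N.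
  exact: leq_trans (leq_mdeg (mJ _ j0J)) (ltnW (deg_gt j0)).
move=> cardm le_card.
(* Brenner's inequality multiplied by [#|J| - 1], with all terms moved to the side where they are
   positive. *)
have key : (D * #|J| + mdeg m <= \sum_(j in J) mdeg (g j) + D)%N.
  have := subE J; lia.
move: key; rewrite -(ler_nat rat) !natrD natrM -/m => key.
have J1 : (2%:R <= #|J|%:R :> rat) by rewrite ler_nat.
rewrite ler_pdivrMr; last by lra.
lra.
Qed.
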